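(* Let $\Omega$ be a stress matrix of rank $k$ of a framework $(G,p)$ on $n$ vertices. Then the following statements are equivalent: 1. There does not exist a real vector $y=(y_{ij})_{\{i,j\}\in\overline{E}(G)}\neq\mathbf{0}$ with $\Omega\big(\sum_{\{i,j\}\in\overline{E}(G)} y_{ij}E^{ij}\big)=\mathbf{0}$. 2. $\Omega$ satisfies the Strong Arnold Property. 3. The set $\mathcal{S}^n_k$ of symmetric $n\times n$ matrices of rank $k$ intersects the subspace $\mathcal{L}$ transversally at $\Omega$.
   Context: A (bar) framework $(G,p)$ in $\mathbb{R}^r$ is a simple graph $G$ on vertices $1,\dots,n$ together with points $p^1,\dots,p^n\in\mathbb{R}^r$. Throughout, $G$ is connected and not complete. $E(G)$ is the edge set of $G$ and $\overline{E}(G)=\{\{i,j\}: i\ne j,\ \{i,j\}\notin E(G)\}$ is the set of missing edges. A stress of $(G,p)$ is a function $\omega:E(G)\to\mathbb{R}$ with $\sum_{j:\{i,j\}\in E(G)}\omega_{ij}(p^i-p^j)=\mathbf{0}$ for all $i$. The associated stress matrix is the $n\times n$ symmetric matrix $\Omega$ with $\Omega_{ij}=-\omega_{ij}$ if $\{i,j\}\in E(G)$, $\Omega_{ij}=0$ if $\{i,j\}\in\overline{E}(G)$, and $\Omega_{ii}=\sum_{k:\{i,k\}\in E(G)}\omega_{ik}$. $E^{ij}$ is the $n\times n$ symmetric matrix with 1's in the $(i,j)$ and $(j,i)$ entries and 0's elsewhere. $\mathcal{S}^n$ is the space of $n\times n$ real symmetric matrices. Strong Arnold Property: a matrix $A\in\mathcal{S}^n$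 with $A_{ij}=0$ for all $\{i,j\}\in\overline{E}(G)$ satisfies the Strong Arnold Property if $Y=\mathbf{0}$ is the only matrix in $\mathcal{S}^n$ such that (i) $Y_{ij}=0$ if $i=j$ or $\{i,j\}\in E(G)$, and (ii) $AY=\mathbf{0}$. Transversality: let $\mathcal{U}$ and $\mathcal{W}$ be matrices whose columns form orthonormal bases of, respectively, the null space and the column space of $\Omega$. Let $\mathcal{S}^n_k=\{A\in\mathcal{S}^n:\operatorname{rank}A=k\}$, whose tangent space at $\Omega$ is $$\mathcal{T}_\Omega=\Big\{A\in\mathcal{S}^n: A=[\mathcal{W}\ \ \mathcal{U}]\begin{bmatrix}\Phi_1&\Phi_2\\ \Phi_2^T&\mathbf{0}\end{bmatrix}\begin{bmatrix}\mathcal{W}^T\\ \mathcal{U}^T\end{bmatrix}\Big\},$$ with $\Phi_1$ ranging over symmetric matrices of order $k$ and $\Phi_2$ over $k\times(n-k)$ matrices. Let $\mathcal{L}=\{A\in\mathcal{S}^n: A_{ij}=0 \text{ whenever } \{i,j\}\in\overline{E}(G)\}$. $\mathcal{S}^n_k$ intersects $\mathcal{L}$ transversally at $\Omega$ if $\mathcal{T}_\Omega+\mathcal{L}=\mathcal{S}^n$. *)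

(* Defs.v *)
From mathcomp Require Import all_boot all_order all_algebra.
From mathcomp Require Import boolp classical_sets reals.

Set Implicit Arguments.
Unset Strict Implicit.
Unset Printing Implicit Defensive.

Import Order.TTheory GRing.Theory Num.Theory.
Local Open Scope classical_set_scope.
Local Open Scope ring_scope.

Section Graphs.
Variables (n : nat) (e : rel 'I_n).

Definition simple_graph : Prop := symmetric e /\ irreflexive e.

Definition connected_graph : Prop := forall i j, connect e i j.

Definition complete_graph : Prop := forall i j, i != j -> e i j.

(* Unordered pairs {i, j} are two-element sets of vertices. *)
Definition missing_edges : {set {set 'I_n}} :=
  [set A : {set 'I_n} |
     [exists i, exists j, [&& i != j, ~~ e i j & A == [set i; j]]]]%SET.

Definition missing_edge : Type := {A : {set 'I_n} | A \in missing_edges}.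

End Graphs.

Section Stress.
Variables (R : realType) (n r : nat) (e : rel 'I_n).

(* A weight on unordered pairs is a function of the set {i, j}, hence symmetric
   in i and j; only its values on the edges of the graph are ever used. *)
Definition is_stress (p : 'I_n -> 'rV[R]_r) (w : {set 'I_n} -> R) : Prop :=
  forall i, \sum_(j | e i j) w [set i; j]%SET *: (p i - p j) = 0.

Definition stress_mx (w : {set 'I_n} -> R) : 'M[R]_n :=
  \matrix_(i, j)
    if i == j then \sum_(k | e i k) w [set i; k]%SET
    else if e i j then - w [set i; j]%SET else 0.

Definition is_stress_mx (p : 'I_n -> 'rV[R]_r) (Omega : 'M[R]_n) : Prop :=
  exists2 w, is_stress p w & Omega = stress_mx w.

End Stress.

Section Matrices.
Variables (R : realType) (n : nat).
Implicit Types (e : rel 'I_n) (A Omega Y : 'M[R]_n) (k : nat).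

(* For A = {i, j}, the matrix E^{ij} with ones exactly at (i, j) and (j, i). *)
Definition pair_mx (A : {set 'I_n}) : 'M[R]_n :=
  \matrix_(i, j) ([set i; j]%SET == A)%:R.

Definition missing_edge_mx e (y : {ffun missing_edge e -> R}) : 'M[R]_n :=
  \sum_(A : missing_edge e) y A *: pair_mx (val A).

Definition symmx : set 'M[R]_n := [set A | A^T = A].

Definition symmx_rank k : set 'M[R]_n := [set A | symmx A /\ \rank A = k].

Definition graph_space e : set 'M[R]_n :=
  [set A | symmx A /\ forall i j, i != j -> ~~ e i j -> A i j = 0].

Definition strong_Arnold e A : Prop :=
  graph_space e A /\
  forall Y, symmx Y -> (forall i j, (i == j) || e i j -> Y i j = 0) ->
    A *m Y = 0 -> Y = 0.

(* Subspaces are row spaces in mxalgebra, hence the transpositions: the columns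
   of B are orthonormal and span the subspace whose elements, transposed, form
   the row space of V. *)
Definition orthonormal_basis m l (B : 'M[R]_(n, l)) (V : 'M[R]_(m, n)) : Prop :=
  B^T *m B = 1%:M /\ (B^T == V)%MS.

Definition column_space_basis l Omega (W : 'M[R]_(n, l)) : Prop :=
  orthonormal_basis W Omega^T.

(* kermx Omega^T is the space of the rows x^T such that Omega *m x = 0. *)
Definition null_space_basis l Omega (U : 'M[R]_(n, l)) : Prop :=
  orthonormal_basis U (kermx Omega^T).

Definition tangent_mx k (W : 'M[R]_(n, k)) (U : 'M[R]_(n, n - k))
    (Phi1 : 'M[R]_k) (Phi2 : 'M[R]_(k, n - k)) : 'M[R]_n :=
  row_mx W U *m block_mx Phi1 Phi2 Phi2^T 0 *m col_mx W^T U^T.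

(* The tangent space of symmx_rank k at Omega. By tangent_spaceP below, it does
   not depend on the choice of the orthonormal bases W and U. *)
Definition tangent_space k Omega : set 'M[R]_n :=
  [set A | exists (W : 'M[R]_(n, k)) (U : 'M[R]_(n, n - k)),
     [/\ column_space_basis Omega W, null_space_basis Omega U &
      exists (Phi1 : 'M[R]_k) (Phi2 : 'M[R]_(k, n - k)),
        Phi1^T = Phi1 /\ A = tangent_mx W U Phi1 Phi2]].

Definition transversal_at e k Omega : Prop :=
  (symmx_rank k `&` graph_space e) Omega /\
  [set A + B | A in tangent_space k Omega & B in graph_space e] = symmx.

Lemma tangent_spaceP k Omega (W : 'M[R]_(n, k)) (U : 'M[R]_(n, n - k)) A :
  symmx Omega -> column_space_basis Omega W -> null_space_basis Omega U ->
  tangent_space k Omega A <->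
  exists (Phi1 : 'M[R]_k) (Phi2 : 'M[R]_(k, n - k)),
    Phi1^T = Phi1 /\ A = tangent_mx W U Phi1 Phi2.
Proof.
move=> symO bW bU; split; last by move=> AP; exists W, U.
have WU0 (W' : 'M_(n, k)) (U' : 'M_(n, n - k)) : column_space_basis Omega W' ->
    null_space_basis Omega U' -> W'^T *m U' = 0.
  move=> [_ /andP[/submxP[X ->] _]] [_ /andP[/sub_kermxP U'0 _]].
  by rewrite -mulmxA -[Omega^T *m U']trmxK trmx_mul trmxK -{1}symO U'0 trmx0 mulmx0.
move=> [W1 [U1 [bW1 bU1 [Phi1 [Phi2 [symPhi defA]]]]]].
have W1U1 := WU0 _ _ bW1 bU1; have WU := WU0 _ _ bW bU.
have symA : A^T = A.
  rewrite defA /tangent_mx !trmx_mul tr_col_mx tr_row_mx !trmxK tr_block_mx.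
  by rewrite trmxK trmx0 symPhi mulmxA.
have U1A : U1^T *m A *m U1 = 0.
  have U1W1 : U1^T *m W1 = 0 by rewrite -[LHS]trmxK trmx_mul trmxK W1U1 trmx0.
  rewrite defA /tangent_mx -!mulmxA (mul_col_mx W1^T) W1U1 (proj1 bU1).
  rewrite !mulmxA mul_mx_row U1W1 (proj1 bU1) mul_row_block mul_row_col.
  by rewrite !(mul0mx, mulmx0, add0r).
have UA : U^T *m A *m U = 0.
  have /submxP[X defU] : (U^T <= U1^T)%MS.
    by case: bU bU1 => _ /andP[UK _] [_ /andP[_ KU1]]; exact: submx_trans UK KU1.
  rewrite -[X in _ *m X]trmxK defU trmx_mul trmxK.
  by rewrite -!mulmxA (mulmxA A) (mulmxA U1^T) (mulmxA U1^T) U1A mul0mx mulmx0.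
pose Q := row_mx W U.
have trQ : Q^T = col_mx W^T U^T by rewrite tr_row_mx.
have QQ : Q^T *m Q = 1%:M.
  rewrite trQ mul_col_row (proj1 bW) (proj1 bU) WU.
  by rewrite -[U^T *m W]trmxK trmx_mul trmxK WU trmx0 -scalar_mx_block.
have kn : (k <= n)%N.
  by rewrite -(mxrank1 R k) -(proj1 bW) (leq_trans (mxrankM_maxl _ _)) ?rank_leq_col.
have QQ1 : Q *m Q^T = 1%:M.
  have gen m (P : 'M[R]_(n, m)) : m = n -> P^T *m P = 1%:M -> P *m P^T = 1%:M.
    by move=> mn; move: P; rewrite mn => P; exact: mulmx1C.
  by apply: gen => //; rewrite subnKC.
exists (W^T *m A *m W), (W^T *m A *m U); split.
  by rewrite !trmx_mul trmxK symA mulmxA.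
have defAQ : A = Q *m (Q^T *m A *m Q) *m Q^T.
  by rewrite !mulmxA QQ1 mul1mx -mulmxA QQ1 mulmx1.
rewrite [LHS]defAQ /tangent_mx -trQ -/Q; congr (_ *m _ *m _).
by rewrite trQ mul_col_mx mul_col_row UA !trmx_mul trmxK symA !mulmxA.
Qed.

End Matrices.

(* Main.v *)
Require Import Defs.
From HB Require Import structures.
From mathcomp Require Import all_boot all_order all_algebra.
From mathcomp Require Import boolp classical_sets reals.
Set Implicit Arguments.
Unset Strict Implicit.

Import Order.TTheory GRing.Theory Num.Theory.
Local Open Scope ring_scope.

(** Writing <A, B> = tr (A B^T), the symmetric matrices Y supported on the
    missing edges form the orthogonal complement of L in S^n, and those with
    Omega Y = 0 the orthogonal complement of the tangent space, which consists
    of the matrices Omega X + (Omega X)^T. Hence the Strong Arnold Property and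
    transversality both say that these two complements meet only in 0. *)

(** * The trace form over a field *)

Section TraceForm.
Variable F : fieldType.

Lemma mxtrace_mul_trE m n (A B : 'M[F]_(m, n)) :
  \tr (A *m B^T) = \sum_i \sum_j A i j * B i j.
Proof.
by apply: eq_bigr => i _; rewrite mxE; apply: eq_bigr => j _; rewrite mxE.
Qed.

Lemma mxvec_mul_tr m n (A B : 'M[F]_(m, n)) :
  mxvec A *m (mxvec B)^T = (\tr (A *m B^T))%:M.
Proof.
rewrite [LHS]mx11_scalar mxE mxtrace_mul_trE; congr (_%:M).
rewrite (reindex _ (curry_mxvec_bij _ _)) /= pair_bigA /=.
by apply: eq_bigr => -[i j] _; rewrite /= !(mxE, mxvecE).
Qed.

(** The range of a linear map is its own double annihilator in finite dimension. No positivity is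
    involved: the columns of a cokernel matrix cut out the row space of [lin_mx h], and each of them
    is a test matrix [C]. *)
Lemma fredholm_alternative m1 n1 m2 n2
    (h : {linear 'M[F]_(m1, n1) -> 'M[F]_(m2, n2)}) (B : 'M[F]_(m2, n2)) :
  (forall C, (forall X, \tr (h X *m C^T) = 0) -> \tr (B *m C^T) = 0) ->
  exists X, B = h X.
Proof.
move=> orthB; suff /submxP[D defB] : (mxvec B <= lin_mx h)%MS.
  by exists (vec_mx D); apply: (can_inj mxvecK); rewrite defB mul_rV_lin.
rewrite submxE; set K := cokermx _; apply/eqP/matrixP.
suff colK j : mxvec B *m col j K = 0.
  move=> i j; have := colK j; rewrite colE mulmxA -colE => /matrixP/(_ i 0).
  by rewrite mxE [in RHS]mxE => ->; rewrite mxE.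
(* Reshaping the cokernel column into a matrix turns multiplication by it into the trace pairing
   with [C]. *)
pose C : 'M_(m2, n2) := vec_mx (col j K)^T.
have defK : col j K = (mxvec C)^T by rewrite vec_mxK trmxK.
rewrite defK mxvec_mul_tr orthB ?raddf0 // => X.
have : (\tr (h X *m C^T))%:M = 0 :> 'M[F]_1.
  rewrite -mxvec_mul_tr -defK -mul_vec_lin -mulmxA colE (mulmxA (lin_mx h)).
  by rewrite mulmx_coker mul0mx mulmx0.
by move/matrixP/(_ 0 0); rewrite !mxE.
Qed.

Lemma mxtrace_mul_eq0 m n (A : 'M[F]_(m, n)) :
  (forall X, \tr (A *m X) = 0) -> A = 0.
Proof.
move=> A0; apply/matrixP=> i j; have := A0 (delta_mx j i).
rewrite mxE /mxtrace (bigD1 i) //= big1 => [|l /negPf li]; rewrite mxE.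
  rewrite addr0 (bigD1 j) //= big1 => [|q /negPf qj]; rewrite mxE.
    by rewrite !eqxx mulr1 addr0.
  by rewrite qj mulr0.
by apply: big1 => q _; rewrite mxE li andbF mulr0.
Qed.

End TraceForm.

(** * Positive definiteness and orthonormal bases *)

Section RealTraceForm.
Variable R : rcfType.

Lemma mxtrace_mul_tr_eq0 m n (A : 'M[R]_(m, n)) : \tr (A *m A^T) = 0 -> A = 0.
Proof.
rewrite mxtrace_mul_trE => /psumr_eq0P A0.
have {}A0 i : \sum_j A i j * A i j = 0.
  by apply: A0 => // l _; apply: sumr_ge0 => j _; rewrite -expr2 sqr_ge0.
apply/matrixP=> i j; rewrite mxE; apply/eqP; rewrite -sqrf_eq0 expr2; apply/eqP.
by apply: (psumr_eq0P _ (A0 i)) => // l _; rewrite -expr2 sqr_ge0.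
Qed.

(** Gram-Schmidt by induction on the rank: normalise a nonzero row of [V] to [u], then recurse on
    the vectors of the row space orthogonal to [u]. *)
Lemma orthonormal_rows_exist m n k (V : 'M[R]_(m, n)) : \rank V = k ->
  exists W : 'M[R]_(k, n), W *m W^T = 1%:M /\ (W == V)%MS.
Proof.
elim: k m V => [|k IHk] m V rkV.
  exists 0; split; first by apply/matrixP=> -[].
  by move/eqP: rkV; rewrite mxrank_eq0 => /eqP ->; rewrite !sub0mx.
pose v := nz_row V.
have v_neq0 : v != 0 by rewrite nz_row_eq0 -mxrank_eq0 rkV.
pose c := \tr (v *m v^T).
have c_gt0 : 0 < c.
  rewrite lt_neqAle eq_sym; apply/andP; split.
    by apply: contraNneq v_neq0 => /mxtrace_mul_tr_eq0 ->.
  rewrite /c mxtrace_mul_trE; apply: sumr_ge0 => i _; apply: sumr_ge0 => j _.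
  by rewrite -expr2 sqr_ge0.
pose u := (Num.sqrt c)^-1 *: v.
have uV : (u <= V)%MS by rewrite scalemx_sub ?nz_row_sub.
have uu : u *m u^T = 1%:M.
  rewrite /u linearZ /= -scalemxAl -scalemxAr scalerA -invfM -expr2.
  rewrite sqr_sqrtr ?ltW // [v *m _]mx11_scalar -trace_mx11 -/c.
  by rewrite scale_scalar_mx mulVf // gt_eqF.
(* Pairing with [u] is a nonzero functional on the row space of [V], so its kernel there loses
   exactly one dimension. *)
have rkVu : \rank (V *m u^T) = 1%N.
  apply/eqP; rewrite eqn_leq rank_leq_col lt0n mxrank_eq0.
  have /submxP[D defu] := uV; apply/eqP => Vu0.
  move: uu; rewrite {1}defu -mulmxA Vu0 mulmx0 => /matrixP/(_ 0 0)/eqP.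
  by rewrite !mxE eqxx eq_sym oner_eq0.
have [|W [WW /andP[WV VW]]] := IHk _ (V :&: kermx u^T)%MS.
  by have := mxrank_mul_ker V u^T; rewrite rkVu rkV add1n => -[].
have Wu : W *m u^T = 0 by apply/sub_kermxP; rewrite (submx_trans WV) ?capmxSr.
have UU : col_mx u W *m (col_mx u W)^T = 1%:M :> 'M_(1 + k).
  rewrite tr_col_mx mul_col_row uu WW Wu -[u *m _]trmxK trmx_mul trmxK Wu.
  by rewrite trmx0 -scalar_mx_block.
exists (col_mx u W : 'M_(1 + k, n)); split=> //.
have UV : (col_mx u W <= V)%MS.
  by rewrite col_mx_sub uV (submx_trans WV) ?capmxSl.
(* The inclusion is an equality by rank: orthonormal rows are independent. *)
rewrite -(mxrank_leqif_eq UV) rkV eqn_leq rank_leq_row.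
rewrite (leq_trans _ (mxrankM_maxl _ (col_mx u W)^T)) //.
by rewrite UU mxrank1.
Qed.

End RealTraceForm.

(** * The tangent space and its orthogonal complement *)

Section TangentSpace.
Variables (R : realType) (n k : nat).
Implicit Types (Omega A Y : 'M[R]_n).

Lemma column_null_bases_exist Omega : \rank Omega = k ->
  exists (W : 'M[R]_(n, k)) (U : 'M[R]_(n, n - k)),
    column_space_basis Omega W /\ null_space_basis Omega U.
Proof.
move=> rkO.
have [|W [WW eqW]] := @orthonormal_rows_exist R _ _ k Omega^T.
  by rewrite mxrank_tr.
have [|U [UU eqU]] := @orthonormal_rows_exist R _ _ (n - k)%N (kermx Omega^T).
  by rewrite mxrank_ker mxrank_tr rkO.
by exists W^T, U^T; rewrite /column_space_basis /null_space_basis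
  /orthonormal_basis !trmxK.
Qed.

(** The columns of [Omega] lie in the span of [W], so [Omega *m X] factors as [W *m Z]; expanding
    [Z] along [W] and [U] leaves no block between [U] and [U]. *)
Lemma tangent_space_sym_mul Omega X : symmx Omega -> \rank Omega = k ->
  tangent_space k Omega (Omega *m X + (Omega *m X)^T).
Proof.
move=> symO rkO.
have [W [U [bW bU]]] := column_null_bases_exist rkO.
exists W, U; split=> //.
have [[WW eqW] [UU eqU]] := (bW, bU).
have /andP[/submxP[D defW] /submxP[D' defO]] := eqW.
have {}defO : Omega = W *m D'^T by rewrite -[LHS]trmxK defO trmx_mul trmxK.
pose Z := D'^T *m X.
have OX : Omega *m X = W *m Z by rewrite defO -mulmxA.
have UW : U^T *m W = 0.
  have /andP[/sub_kermxP UO _] := eqU.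
  by rewrite -[W]trmxK defW trmx_mul trmxK -{1}symO mulmxA UO mul0mx.
have QQ : W *m W^T + U *m U^T = 1%:M.
  have kn : (k <= n)%N by rewrite -rkO rank_leq_row.
  (* The width [k + (n - k)] equals [n] only propositionally, hence the detour through a generic [m]
     before a left inverse can become a right inverse. *)
  have gen m (P : 'M[R]_(n, m)) : m = n -> P^T *m P = 1%:M -> P *m P^T = 1%:M.
    by move=> mn; move: P; rewrite mn => P; exact: mulmx1C.
  rewrite -mul_row_col -tr_row_mx gen ?subnKC // tr_row_mx mul_col_row.
  rewrite WW UU UW -[W^T *m U]trmxK trmx_mul trmxK UW trmx0.
  by rewrite -scalar_mx_block.
(* These are the coefficients found by inserting [W *m W^T + U *m U^T] to the right of [Z] and
   adding the transpose. *)
exists (Z *m W + (Z *m W)^T), (Z *m U); split.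
  by rewrite linearD /= trmxK addrC.
rewrite OX /tangent_mx mul_row_block mul_row_col mulmx0 addr0.
have -> : W *m Z = W *m (Z *m (W *m W^T + U *m U^T)) by rewrite QQ mulmx1.
rewrite !(mulmxDr, mulmxDl, linearD) /= !trmx_mul !trmxK !mulmxA.
by rewrite -!addrA; congr (_ + _); rewrite [LHS]addrC -addrA.
Qed.

(** Each term of a tangent matrix begins with [W] or ends with [W^T], and [Y] annihilates [W] on
    both sides; cyclicity of the trace does the rest. *)
Lemma tangent_space_orthogonal Omega A Y : symmx Omega ->
  tangent_space k Omega A -> symmx Y -> Omega *m Y = 0 -> \tr (A *m Y^T) = 0.
Proof.
move=> symO [W [U [[_ /andP[/submxP[D defW] _]] _ [P1 [P2 [_ ->]]]]]] symY OY.
have WY : W^T *m Y = 0 by rewrite defW symO -mulmxA OY mulmx0.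
have YW : Y *m W = 0 by rewrite -[LHS]trmxK trmx_mul symY WY trmx0.
rewrite symY /tangent_mx mul_row_block mul_row_col mulmx0 addr0.
rewrite !mulmxDl -!mulmxA WY !mulmx0 !add0r.
by rewrite mxtrace_mulC -!mulmxA YW !mulmx0 mxtrace0.
Qed.

End TangentSpace.

(** * Matrices supported on the missing edges *)

Lemma set2_inj (T : finType) (a b c d : T) : [set a; b]%SET = [set c; d]%SET ->
  a = c /\ b = d \/ a = d /\ b = c.
Proof.
move=> eqs.
have : a \in [set c; d]%SET by rewrite -eqs !inE eqxx.
have : b \in [set c; d]%SET by rewrite -eqs !inE eqxx orbT.
have : c \in [set a; b]%SET by rewrite eqs !inE eqxx.
have : d \in [set a; b]%SET by rewrite eqs !inE eqxx orbT.
rewrite !inE => /orP[] /eqP hd /orP[] /eqP hc /orP[] /eqP hb /orP[] /eqP ha;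
  by [left; split; congruence | right; split; congruence].
Qed.

Section MissingEdges.
Variables (R : realType) (n : nat) (e : rel 'I_n).
Hypothesis e_sym : symmetric e.
Implicit Types (A B Y Omega : 'M[R]_n) (k : nat) (y : {ffun missing_edge e -> R}).

Lemma mem_missing_edges i j :
  ([set i; j]%SET \in missing_edges e) = (i != j) && ~~ e i j.
Proof.
rewrite inE; apply/existsP/idP => [[a /existsP[b /and3P[ab eab /eqP eqs]]]|].
  by case: (set2_inj eqs) => -[-> ->]; rewrite ?ab // eq_sym ab e_sym.
by case/andP=> ij eij; exists i; apply/existsP; exists j; rewrite ij eij eqxx.
Qed.

Lemma missing_edgeP (A : missing_edge e) :
  exists i j, [/\ i != j, ~~ e i j & val A = [set i; j]%SET].
Proof.
have := valP A; rewrite inE => /existsP[i /existsP[j /and3P[ij eij /eqP eA]]].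
by exists i, j.
Qed.

Lemma missing_edge_mxE y (A : missing_edge e) i j :
  val A = [set i; j]%SET -> missing_edge_mx y i j = y A.
Proof.
move=> eA; rewrite /missing_edge_mx summxE (bigD1 A) //= !mxE eA eqxx mulr1.
rewrite big1 ?addr0 // => B neqBA; rewrite !mxE -eA.
by rewrite val_eqE eq_sym (negPf neqBA) mulr0.
Qed.

Lemma missing_edge_mx_out y i j :
  (i == j) || e i j -> missing_edge_mx y i j = 0.
Proof.
move=> ij; rewrite /missing_edge_mx summxE big1 // => A _; rewrite !mxE.
case: eqP => [eA|_]; last by rewrite mulr0.
by have := valP A; rewrite -eA mem_missing_edges -negb_or ij.
Qed.

Lemma missing_edge_mx_sym y : symmx (missing_edge_mx y).
Proof.
apply/matrixP=> i j; rewrite mxE /missing_edge_mx !summxE.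
by apply: eq_bigr => A _; rewrite !mxE finset.setUC.
Qed.

Lemma missing_edge_mx_eq0 y : missing_edge_mx y = 0 -> y = 0.
Proof.
move=> Y0; apply/ffunP=> A; have [i [j [_ _ eA]]] := missing_edgeP A.
by rewrite -(missing_edge_mxE y eA) Y0 mxE ffunE.
Qed.

Lemma missing_edge_mx_surj Y : symmx Y ->
  (forall i j, (i == j) || e i j -> Y i j = 0) ->
  exists y, missing_edge_mx y = Y.
Proof.
move=> symY Y0.
(* A missing edge {i, j} selects the two equal entries (i, j) and (j, i) of Y. *)
pose y : {ffun missing_edge e -> R} := [ffun A =>
  if [pick ij | [set ij.1; ij.2]%SET == val A] is Some ij then Y ij.1 ij.2
  else 0].
exists y; apply/matrixP=> i j; case: (boolP ((i == j) || e i j)) => ij.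
  by rewrite missing_edge_mx_out ?Y0.
have Aij : [set i; j]%SET \in missing_edges e.
  by rewrite mem_missing_edges -negb_or.
rewrite (@missing_edge_mxE y (Sub [set i; j]%SET Aij)) ?SubK // ffunE.
case: pickP => [[a b] /= /eqP eqs|/(_ (i, j))]; last by rewrite SubK /= eqxx.
have symYij : Y j i = Y i j by rewrite -{1}symY mxE.
by case: (set2_inj eqs) => -[-> ->].
Qed.

(** * The graph space and the projection along it *)

Lemma graph_space_orthogonal B Y : graph_space e B ->
  (forall i j, (i == j) || e i j -> Y i j = 0) -> \tr (B *m Y^T) = 0.
Proof.
move=> [_ B0] Y0; rewrite mxtrace_mul_trE big1 // => i _; rewrite big1 // => j _.
case: (boolP ((i == j) || e i j)) => [/Y0->|]; first by rewrite mulr0.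
by rewrite negb_or => /andP[ij eij]; rewrite B0 ?mul0r.
Qed.

(** Among symmetric matrices its kernel is [graph_space e], so decomposing a matrix as tangent plus
    graph space amounts to matching missing parts. *)
Definition missing_part A : 'M[R]_n :=
  \matrix_(i, j) if (i == j) || e i j then 0 else A i j.

Lemma missing_part_is_linear : linear missing_part.
Proof.
move=> a A B; apply/matrixP=> i j; rewrite !mxE.
by case: ifP => // _; rewrite mulr0 addr0.
Qed.

Lemma missing_part_adjoint A B :
  \tr (missing_part A *m B^T) = \tr (A *m (missing_part B)^T).
Proof.
rewrite !mxtrace_mul_trE; apply: eq_bigr => i _; apply: eq_bigr => j _.
by rewrite !mxE; case: ifP => // _; rewrite mul0r mulr0.
Qed.

(** Solvability in [X] is tested by the Fredholm alternative: a [C] orthogonal to the range yields a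
    matrix [Y] that the Strong Arnold Property forces to vanish. *)
Lemma strong_Arnold_missing_part Omega A : symmx Omega -> symmx A ->
  strong_Arnold e Omega ->
  exists X, missing_part A = missing_part (Omega *m X + (Omega *m X)^T).
Proof.
move=> symO symA [_ SAP].
pose h X := missing_part (Omega *m X + (Omega *m X)^T).
have h_lin : linear h.
  move=> a X Y; rewrite -missing_part_is_linear; congr missing_part.
  by rewrite mulmxDr -scalemxAr !linearD linearZ /= addrACA.
pose hL : {linear 'M[R]_n -> 'M[R]_n} :=
  HB.pack h (GRing.isLinear.Build R 'M[R]_n 'M[R]_n *:%R h h_lin).
apply: (fredholm_alternative (h := hL)) => C /= orthC.
(* [C] need not be symmetric, but symmetric matrices pair only with the symmetric part of [M]. *)
pose M := missing_part C; pose Y := M + M^T.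
have trM (B : 'M[R]_n) : \tr (B^T *m M^T) = \tr (B *m M).
  by rewrite -trmx_mul mxtrace_tr mxtrace_mulC.
have Y_eq0 : Y = 0.
  apply: SAP.
  - by rewrite /symmx /= linearD /= trmxK addrC.
  - move=> i j ij; rewrite !mxE ij (eq_sym j) (e_sym j) ij addr0 //.
  - have YO : Y *m Omega = 0.
      apply: mxtrace_mul_eq0 => X; rewrite -mulmxA mxtrace_mulC.
      have := orthC X; rewrite missing_part_adjoint -/M mulmxDl raddfD /= trM.
      by rewrite mulmxDr raddfD /= addrC.
    have symY : Y^T = Y by rewrite linearD /= trmxK addrC.
    by rewrite -[LHS]trmxK trmx_mul symY symO YO trmx0.
rewrite missing_part_adjoint -/M.
(* As [A] is symmetric, this trace is twice the pairing of [A] with [M], and 2 is nonzero in [R]. *)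
have /eqP : \tr (A *m Y) = 0 by rewrite Y_eq0 mulmx0 mxtrace0.
rewrite mulmxDr raddfD /= -[X in X + _]trM symA -mulr2n mulrn_eq0 /=.
by move/eqP.
Qed.

(** * The cycle of implications *)

Lemma no_kernel_strong_Arnold Omega : symmx Omega -> graph_space e Omega ->
  ~ (exists y, y <> 0 /\ Omega *m @missing_edge_mx R n e y = 0) ->
  strong_Arnold e Omega.
Proof.
move=> symO gO noy; split=> // Y symY Y0 OY.
have [y defY] := missing_edge_mx_surj symY Y0.
rewrite -defY; case: (eqVneq y 0) => [->|/eqP y0]; last first.
  by case: noy; exists y; rewrite defY.
by rewrite /missing_edge_mx big1 // => A _; rewrite ffunE scale0r.
Qed.

Lemma strong_Arnold_transversal k Omega : \rank Omega = k ->
  strong_Arnold e Omega -> transversal_at e k Omega.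
Proof.
move=> rkO SAP; have [gO _] := SAP; have [symO _] := gO.
split; first by [].
apply/seteqP; split=> [_ [A tA [B [symB _] <-]]|S symS].
  case: tA => W [U [_ _ [P1 [P2 [symP ->]]]]].
  rewrite /symmx /= linearD /= symB; congr (_ + _).
  rewrite /tangent_mx !trmx_mul tr_col_mx tr_row_mx !trmxK tr_block_mx.
  by rewrite trmxK trmx0 symP mulmxA.
(* [X] gives a tangent matrix with the missing part of [S]; the remainder then lies in the graph
   space. *)
have [X eqX] := strong_Arnold_missing_part symO symS SAP.
pose A := Omega *m X + (Omega *m X)^T.
exists A; first exact: tangent_space_sym_mul.
exists (S - A); last by rewrite addrC subrK.
split.
  rewrite /symmx /= linearB /= symS; congr (_ - _).
  by rewrite linearD /= trmxK addrC.
move=> i j ij eij; have /matrixP/(_ i j) := eqX.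
by rewrite !mxE (negPf ij) (negPf eij) /= => ->; rewrite subrr.
Qed.

Lemma transversal_no_kernel k Omega : transversal_at e k Omega ->
  ~ (exists y, y <> 0 /\ Omega *m @missing_edge_mx R n e y = 0).
Proof.
move=> [[[symO _] _] tr] [y [y0 OY]]; apply: y0; apply: missing_edge_mx_eq0.
have symY := missing_edge_mx_sym y; have Y0 := missing_edge_mx_out y.
(* By transversality the kernel matrix is itself a sum of two matrices orthogonal to it, so its norm
   is zero. *)
apply: mxtrace_mul_tr_eq0.
have : symmx (missing_edge_mx y) by [].
rewrite -tr => -[A tA [B gB eqY]].
rewrite -{1}eqY mulmxDl raddfD /= (tangent_space_orthogonal symO tA) //.
by rewrite (graph_space_orthogonal gB) // addr0.
Qed.

End MissingEdges.

Lemma stress_mx_graph_space (R : realType) (n : nat) (e : rel 'I_n)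
  (w : {set 'I_n} -> R) : symmetric e -> graph_space e (stress_mx e w).
Proof.
move=> e_sym; split.
  apply/matrixP=> i j; rewrite !mxE (eq_sym j) (e_sym j) finset.setUC.
  by case: eqP => // ->.
by move=> i j ij eij; rewrite mxE (negPf ij) (negPf eij).
Qed.

Theorem mainTheorem3 (R : realType) (n r k : nat) (e : rel 'I_n)
    (p : 'I_n -> 'rV[R]_r) (Omega : 'M[R]_n)
    (e_simple : simple_graph e)
    (e_connected : connected_graph e)
    (e_not_complete : ~ complete_graph e)
    (Omega_stress : is_stress_mx e p Omega)
    (Omega_rank : \rank Omega = k) :
  [<-> ~ (exists y : {ffun missing_edge e -> R},
            y <> 0 /\ Omega *m missing_edge_mx y = 0);
       strong_Arnold e Omega;
       transversal_at e k Omega].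
Proof.
have [e_sym _] := e_simple.
have gO : graph_space e Omega.
  by have [w _ ->] := Omega_stress; exact: stress_mx_graph_space.
tfae.
- by apply: no_kernel_strong_Arnold => //; case: gO.
- exact: strong_Arnold_transversal.
- exact: transversal_no_kernel.
Qed.
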